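(* Let $\mu>0$, let $f_1,\dots,f_n:\mathbb{R}^d\to\mathbb{R}$ be differentiable and $\mu$-strongly convex, and let $f=\frac1n\sum_{i=1}^n f_i$. Suppose that $f$ and $f_1,\dots,f_n$ are all $L$-smooth, and let $x_\ast$ be the minimizer of $f$. Then for Random Reshuffling or Shuffle-Once run for $T$ epochs from $x_0\in\mathbb{R}^d$ with a constant stepsize $0<\gamma\le\frac1L$, the iterates generated by either of the algorithms satisfy $$\mathbb{E}\left[\|x_T-x_\ast\|^2\right]\le(1-\gamma\mu)^{nT}\|x_0-x_\ast\|^2+\frac{2\gamma\,\sigma_{\mathrm{Shuffle}}^2}{\mu}.$$
   Context: $L$-smooth means that the gradient is $L$-Lipschitz. Algorithms. Both algorithms take a stepsize $\gamma>0$, a starting point $x_0\in\mathbb{R}^d$ and a number of epochs $T$. Random Reshuffling (RR): in each epoch $t=0,1,\dots,T-1$, sample afresh (independently) a uniformly random permutation $\pi=(\pi_0,\pi_1,\dots,\pi_{n-1})$ of $\{1,\dots,n\}$, set $x_t^0=x_t$, perform $x_t^{i+1}=x_t^i-\gamma\nabla f_{\pi_i}(x_t^i)$ for $i=0,1,\dots,n-1$, and set $x_{t+1}=x_t^n$. Shuffle-Once (SO): identical, except that a single uniformly random permutation $\pi$ is sampled once before the first epoch and is used in all epochs. The expectation is over the random permutations. Bregman divergence: $D_{h}(x,y)=h(x)-h(y)-\langle\nabla h(y),x-y\rangle$. Shuffling variance: for a stepsize $\gamma>0$ and a uniformly random permutation $\pi=(\pi_0,\dots,\pi_{n-1})$ of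 $\{1,\dots,n\}$, let $x_\ast^i=x_\ast-\gamma\sum_{j=0}^{i-1}\nabla f_{\pi_j}(x_\ast)$ for $i=1,\dots,n-1$, and define $$\sigma_{\mathrm{Shuffle}}^2=\max_{i=1,\dots,n-1}\left[\frac1\gamma\,\mathbb{E}\left[D_{f_{\pi_i}}(x_\ast^i,x_\ast)\right]\right],$$ the expectation being over $\pi$ (for $n=1$ the maximum over the empty set is read as $0$). *)

(* Defs.v *)
From HB Require Import structures.
From mathcomp Require Import all_boot all_order all_algebra all_fingroup.
From mathcomp Require Import all_classical all_reals all_analysis.

Set Implicit Arguments.
Unset Strict Implicit.
Unset Printing Implicit Defensive.

Import Order.TTheory GRing.Theory Num.Theory.
Import numFieldNormedType.Exports.

Local Open Scope ring_scope.

(* R^d is 'rV[R]_d.  The library norm on matrices is the sup norm, hence the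
   explicit Euclidean structure below; the two norms induce the same topology,
   so the library's [differentiable] is the usual notion. *)

Definition dot (R : realType) (d : nat) (u v : 'rV[R]_d) : R :=
  \sum_(i < d) u 0 i * v 0 i.

Definition enorm (R : realType) (d : nat) (u : 'rV[R]_d) : R :=
  Num.sqrt (dot u u).

Definition gradient (R : realType) (d : nat) (h : 'rV[R]_d -> R)
    (x : 'rV[R]_d) : 'rV[R]_d :=
  \row_(i < d) 'D_(delta_mx 0 i) h x.

Definition smooth (R : realType) (d : nat) (L : R) (h : 'rV[R]_d -> R) : Prop :=
  forall x y : 'rV[R]_d,
    enorm (gradient h x - gradient h y) <= L * enorm (x - y).

Definition strongly_convex (R : realType) (d : nat) (mu : R)
    (h : 'rV[R]_d -> R) : Prop :=
  forall (x y : 'rV[R]_d) (t : R), 0 <= t <= 1 ->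
    h (t *: x + (1 - t) *: y) <=
      t * h x + (1 - t) * h y - mu / 2 * t * (1 - t) * enorm (x - y) ^+ 2.

Definition is_minimizer (R : realType) (d : nat) (h : 'rV[R]_d -> R)
    (z : 'rV[R]_d) : Prop :=
  forall x : 'rV[R]_d, h z <= h x.

Definition bregman (R : realType) (d : nat) (h : 'rV[R]_d -> R)
    (x y : 'rV[R]_d) : R :=
  h x - h y - dot (gradient h y) (x - y).

Definition average (R : realType) (d n : nat) (f : 'I_n -> 'rV[R]_d -> R)
    (x : 'rV[R]_d) : R :=
  n%:R^-1 * \sum_(i < n) f i x.

(* W carries the uniform distribution. *)
Definition expect (R : realType) (W : finType) (F : W -> R) : R :=
  (\sum_(w : W) F w) / #|W|%:R.

(* One epoch from x; the ordinals of [enum 'I_n] are visited in the order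
   0, 1, ..., n - 1. *)
Definition epoch (R : realType) (d n : nat) (f : 'I_n -> 'rV[R]_d -> R)
    (gamma : R) (x : 'rV[R]_d) (s : 'S_n) : 'rV[R]_d :=
  foldl (fun (y : 'rV[R]_d) (i : 'I_n) => y - gamma *: gradient (f (s i)) y)
    x (enum 'I_n).

(* The t-th entry of ss is the permutation used in epoch t. *)
Definition run (R : realType) (d n : nat) (f : 'I_n -> 'rV[R]_d -> R)
    (gamma : R) (x0 : 'rV[R]_d) (ss : seq 'S_n) : 'rV[R]_d :=
  foldl (epoch f gamma) x0 ss.

(* Random Reshuffling: independent uniform permutations
   pi_0, ..., pi_(T-1) are the same thing as a uniform T-tuple. *)
Definition RR_error (R : realType) (d n : nat) (f : 'I_n -> 'rV[R]_d -> R)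
    (gamma : R) (x0 xs : 'rV[R]_d) (T : nat) : R :=
  expect (fun ss : T.-tuple 'S_n => enorm (run f gamma x0 ss - xs) ^+ 2).

(* Shuffle-Once: a single uniform permutation for all epochs. *)
Definition SO_error (R : realType) (d n : nat) (f : 'I_n -> 'rV[R]_d -> R)
    (gamma : R) (x0 xs : 'rV[R]_d) (T : nat) : R :=
  expect (fun s : 'S_n => enorm (run f gamma x0 (nseq T s) - xs) ^+ 2).

Definition shifted_opt (R : realType) (d n : nat) (f : 'I_n -> 'rV[R]_d -> R)
    (gamma : R) (xs : 'rV[R]_d) (s : 'S_n) (i : nat) : 'rV[R]_d :=
  xs - gamma *: \sum_(j < n | (j < i)%N) gradient (f (s j)) xs.

(* The neutral element 0 gives the value for n = 1; for
   n > 1 it does not affect the maximum when the f i are convex, since their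
   Bregman divergences are then nonnegative. *)
Definition shuffling_variance (R : realType) (d n : nat)
    (f : 'I_n -> 'rV[R]_d -> R) (gamma : R) (xs : 'rV[R]_d) : R :=
  \big[Num.max/0]_(i < n | (0 < i)%N)
    (gamma^-1 *
     expect (fun s : 'S_n => bregman (f (s i)) (shifted_opt f gamma xs s i) xs)).

(* Main.v *)
(* One gradient step with h = f_(pi_i) contracts the distance between the iterate
   x and the shifted optimum z = x_*^i, provided z is moved by the gradient of h
   at xs: by the three-point identity
     <grad h x - grad h xs, x - z> = D_h(z, x) + D_h(x, xs) - D_h(z, xs),
   where the first divergence dominates mu/2 |x - z|^2 by strong convexity and
   the second absorbs the squared gradient difference by smoothness. The
   gradients at xs sum to 0, so z is back at xs after an epoch, and an epoch maps
   |x - xs|^2 below (1 - gamma mu)^n |x - xs|^2 plus a noise depending only on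
   the permutation, whose mean is at most
   (2 gamma sigma^2 / mu) (1 - (1 - gamma mu)^n). The contraction holds for every
   permutation, so independence between the epochs plays no role in summing it. *)

Require Import Defs.
From HB Require Import structures.
From mathcomp Require Import all_boot all_order all_algebra all_fingroup.
From mathcomp Require Import all_classical all_reals all_analysis.
From mathcomp Require Import ring lra.

Import Order.TTheory GRing.Theory Num.Theory.
Import numFieldNormedType.Exports.

Local Open Scope ring_scope.

(** * Euclidean inner product *)

Section Dot.
Context {R : realType} {d : nat}.
Implicit Types u v w : 'rV[R]_d.

Lemma dotC u v : dot u v = dot v u.
Proof. by apply: eq_bigr => i _; rewrite mulrC. Qed.

Lemma dotDl u v w : dot (u + v) w = dot u w + dot v w.
Proof. by rewrite -big_split; apply: eq_bigr => i _; rewrite mxE mulrDl. Qed.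

Lemma dotZl a u v : dot (a *: u) v = a * dot u v.
Proof. by rewrite mulr_sumr; apply: eq_bigr => i _; rewrite mxE mulrA. Qed.

Lemma dotNl u v : dot (- u) v = - dot u v.
Proof. by rewrite -scaleN1r dotZl mulN1r. Qed.

Lemma dotDr u v w : dot u (v + w) = dot u v + dot u w.
Proof. by rewrite dotC dotDl !(dotC u). Qed.

Lemma dotZr a u v : dot u (a *: v) = a * dot u v.
Proof. by rewrite dotC dotZl dotC. Qed.

Lemma dotNr u v : dot u (- v) = - dot u v.
Proof. by rewrite dotC dotNl dotC. Qed.

Lemma dot0l v : dot 0 v = 0.
Proof. by rewrite -(scale0r v) dotZl mul0r. Qed.

Lemma dot_suml (I : finType) (F : I -> 'rV[R]_d) v :
  dot (\sum_i F i) v = \sum_i dot (F i) v.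
Proof.
by elim/big_ind2: _ => [|u1 a u2 b <- <-|//]; rewrite ?dot0l ?dotDl.
Qed.

Definition dotE := (dotDl, dotDr, dotNl, dotNr, dotZl, dotZr).

Lemma dot_ge0 u : 0 <= dot u u.
Proof. by apply: sumr_ge0 => i _; rewrite -expr2 sqr_ge0. Qed.

Lemma dot_eq0 u : (dot u u == 0) = (u == 0).
Proof.
rewrite psumr_eq0; last by move=> i _; rewrite -expr2 sqr_ge0.
apply/allP/eqP => [u0|-> i _]; last by rewrite mxE mul0r eqxx.
apply/rowP => i; rewrite mxE; apply/eqP.
by have := u0 i (mem_index_enum i); rewrite -expr2 sqrf_eq0.
Qed.

Lemma enorm_sqr u : enorm u ^+ 2 = dot u u.
Proof. by rewrite sqr_sqrtr // dot_ge0. Qed.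

End Dot.

(** * Bregman divergences of strongly convex and smooth functions *)

Section Bregman.
Context {R : realType} {d : nat}.
Context {h : 'rV[R]_d -> R} (hdiff : forall x, differentiable h x).

Lemma derive_gradient x v : 'D_v h x = dot (gradient h x) v.
Proof.
rewrite deriveE // [in LHS](row_sum_delta v) linear_sum; apply: eq_bigr => i _.
by rewrite linearZ /= !mxE deriveE // mulrC.
Qed.

Lemma is_derive_line x v (t : R) :
  is_derive t (1 : R) (fun s : R => h (x + s *: v))
    (dot (gradient h (x + t *: v)) v).
Proof.
have E : (fun k : R => k^-1 *: ((fun s : R => h (x + s *: v)) (k *: 1 + t)
            - h (x + t *: v))) =
   (fun k : R => k^-1 *: (h (k *: v + (x + t *: v)) - h (x + t *: v))).
  apply: funext => k; do 3 congr (_ _).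
  by rewrite [k *: 1]mulr1 scalerDl addrCA.
have D : derivable h (x + t *: v) v by exact: diff_derivable.
split; first by rewrite /derivable /= E.
by rewrite -derive_gradient /derive /= E.
Qed.

(** Strong convexity at [k *: x + (1 - k) *: y] is divided by [k]; as [k] tends to 0 from the right,
    the difference quotient becomes the derivative along [x - y]. *)
Lemma bregman_ge mu x y : strongly_convex mu h ->
  mu / 2 * dot (x - y) (x - y) <= bregman h x y.
Proof.
move=> hc; rewrite /bregman -derive_gradient.
set v := x - y.
have D : derivable h y v by exact: diff_derivable.
have cv : ((fun k : R => k^-1 *: (h (k *: v + y) - h y)
             + (1 - k) * (mu / 2 * dot v v)) @ (0 : R)^'+
          --> 'D_v h y + (1 - 0) * (mu / 2 * dot v v))%classic.
  apply: cvgD.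
    exact: cvg_dnbhs_at_right D.
  apply: cvgM; last exact: cvg_cst.
  apply: cvg_at_right_filter; apply: cvgB; [exact: cvg_cst|exact: cvg_id].
suff : 'D_v h y + (1 - 0) * (mu / 2 * dot v v) <= h x - h y by lra.
rewrite -(cvg_lim _ cv) //; apply: limr_le; first by apply: cvgP cv.
near=> k.
have k0 : 0 < k by [].
have k1 : k <= 1 by near: k; apply: nbhs_right_le.
have := hc x y k; rewrite (ltW k0) k1 enorm_sqr -/v => /(_ isT).
have -> : k *: x + (1 - k) *: y = k *: v + y.
  by rewrite /v scalerBr scalerBl scale1r addrA addrAC.
move=> H.
have : k^-1 * (h (k *: v + y) - h y) <= h x - h y - mu / 2 * (1 - k) * dot v v.
  by rewrite mulrC ler_pdivrMr //; nra.
by rewrite -[k^-1 *: _]/(k^-1 * _); lra.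
Unshelve. all: by end_near. Qed.

Lemma smooth_dot L x y : 0 <= L -> smooth L h ->
  dot (gradient h x - gradient h y) (gradient h x - gradient h y)
    <= L ^+ 2 * dot (x - y) (x - y).
Proof.
move=> L0 /(_ x y) H; rewrite -!enorm_sqr -exprMn.
by rewrite lerXn2r // nnegrE ?mulr_ge0 // sqrtr_ge0.
Qed.

(** Descent lemma: [psi] is [h] along the segment minus its quadratic model, and its derivative
    [dpsi] is nonpositive at the mean value point, so [psi 1 <= psi 0]. *)
Lemma bregman_le L x y : 0 < L -> smooth L h ->
  bregman h x y <= L / 2 * dot (x - y) (x - y).
Proof.
move=> L0 hs; have [v vE] : exists v, v = x - y by exists (x - y).
have -> : x = y + v by rewrite vE addrC subrK.
rewrite /bregman.
have -> : y + v - y = v by rewrite addrC addKr.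
pose a := dot (gradient h y) v.
pose psi (t : R) := h (y + t *: v) - (t * a + t ^+ 2 * (L / 2 * dot v v)).
pose dpsi (t : R) := dot (gradient h (y + t *: v)) v - (a + t * (L * dot v v)).
have dpsiE t : is_derive t (1 : R) psi (dpsi t).
  have ? := is_derive_line y v t.
  rewrite /psi /dpsi; apply: is_derive_eq.
  by congr (_ - _); rewrite /GRing.scale /= !mulr0 !mulr1 !add0r; lra.
have [|c c01] := @MVT R psi dpsi 0 1 ltr01.
- by apply: continuous_subspaceT => t; apply/differentiable_continuous/derivable1_diffP.
have c0 : 0 < c by have := c01; rewrite in_itv /= => /andP[].
rewrite subr0 mulr1 => E.
have : dpsi c <= 0.
  rewrite /dpsi /a.
  have := smooth_dot L (y + c *: v) y (ltW L0) hs.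
  have -> : y + c *: v - y = c *: v by rewrite addrC addKr.
  set g := gradient h (y + _); set g0 := gradient h y.
  (* This square stands in for Cauchy-Schwarz: with |g - g0| <= L c |v| it bounds <g - g0, v> by L c
     |v|^2. *)
  have := dot_ge0 ((g - g0) - (L * c) *: v).
  rewrite !dotE (dotC g0 g) (dotC v g) (dotC v g0) => H1 H2.
  have Lc : 0 < L * c by rewrite mulr_gt0.
  rewrite -(pmulr_rle0 _ Lc).
  nra.
rewrite -E /psi scale1r scale0r addr0 -/a; lra.
Qed.

Lemma bregman_three_points x y z :
  dot (gradient h x - gradient h y) (x - z) =
  bregman h z x + bregman h x y - bregman h z y.
Proof. by rewrite /bregman !dotE; ring. Qed.

(* The convex function [bregman h ^~ y] is nonnegative also at the point
   reached from [x] by a gradient step of length [1 / L]. *)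
Lemma bregman_ge_gradient mu L x y : 0 <= mu -> 0 < L ->
  strongly_convex mu h -> smooth L h ->
  dot (gradient h x - gradient h y) (gradient h x - gradient h y)
    <= 2 * L * bregman h x y.
Proof.
move=> mu0 L0 hc hs; have [g gE] : exists g, g = gradient h x - gradient h y by eexists.
rewrite -gE; pose z := x - L^-1 *: g.
have B0 : 0 <= bregman h z y.
  by apply: le_trans (bregman_ge mu z y hc); rewrite mulr_ge0 ?dot_ge0 // divr_ge0.
(* Since x - z = g / L, the three-point identity has left side |g|^2 / L, and D_h(z, x) accounts for
   at most half of it. *)
have := bregman_le L z x L0 hs.
have := bregman_three_points x y z.
have -> : x - z = L^-1 *: g by rewrite /z opprB addrC subrK.
have -> : z - x = - (L^-1 *: g) by rewrite /z addrC addKr.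
rewrite -gE !dotE => E1 E2.
have LV : L * L^-1 = 1 by rewrite divff // gt_eqF.
have Li : 0 < L^-1 by rewrite invr_gt0.
have : L^-1 * dot g g <= 2 * bregman h x y.
  move: E2; rewrite opprK.
  have -> : L / 2 * (L^-1 * (L^-1 * dot g g)) = (L * L^-1) * (L^-1 * dot g g) / 2.
    by ring.
  rewrite LV; lra.
by move=> H; rewrite -mulrA mulrCA -ler_pdivrMl.
Qed.

End Bregman.

(** Two distinct points, which exist as [0 < d], have a divergence between mu/2 and L/2 times their
    squared distance. With gamma L <= 1 this makes the factor 1 - gamma mu nonnegative. *)
Lemma strongly_convex_le_smooth (R : realType) (d : nat) (mu L : R)
    (h : 'rV[R]_d -> R) :
  (0 < d)%N -> 0 < L -> (forall x, differentiable h x) ->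
  strongly_convex mu h -> smooth L h -> mu <= L.
Proof.
move=> d0 L0 hdiff hc hs; pose u : 'rV[R]_d := const_mx 1.
have : u != 0.
  by apply/eqP => /rowP /(_ (Ordinal d0)) /eqP; rewrite !mxE oner_eq0.
rewrite -dot_eq0 => uu; have u0 : 0 < dot u u by rewrite lt_def uu dot_ge0.
have := le_trans (bregman_ge hdiff mu u 0 hc) (bregman_le hdiff L u 0 L0 hs).
by rewrite subr0 ler_pM2r // ler_pM2r // invr_gt0.
Qed.

Lemma gradient_step_contract (R : realType) (d : nat) (mu L gamma : R)
    (h : 'rV[R]_d -> R) (x y z : 'rV[R]_d) :
  (forall u, differentiable h u) -> strongly_convex mu h -> smooth L h ->
  0 <= mu -> 0 < gamma -> 0 < L -> gamma * L <= 1 ->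
  enorm ((x - gamma *: gradient h x) - (z - gamma *: gradient h y)) ^+ 2
    <= (1 - gamma * mu) * enorm (x - z) ^+ 2 + 2 * gamma * bregman h z y.
Proof.
move=> hdiff hc hs mu0 g0 L0 gL; rewrite !enorm_sqr.
have B1 := bregman_ge hdiff mu z x hc.
have B2 := bregman_ge_gradient hdiff mu L x y mu0 L0 hc hs.
have B0 : 0 <= bregman h x y.
  by apply: le_trans (bregman_ge hdiff mu x y hc); rewrite mulr_ge0 ?dot_ge0 // divr_ge0.
have B3 := bregman_three_points x y z (h := h).
move: B1 B2 B3; rewrite -(opprB x z) dotNl dotNr opprK.
have -> : x - gamma *: gradient h x - (z - gamma *: gradient h y) =
          (x - z) - gamma *: (gradient h x - gradient h y).
  by apply/rowP => i; rewrite !mxE; ring.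
move: (x - z) (gradient h x - gradient h y) => u g B1 B2 B3.
rewrite !dotE (dotC u g) B3.
(* By gamma L <= 1, the term gamma^2 |g|^2 of the expanded square is absorbed by the -2 gamma D_h(x,
   y) of the cross term. *)
have B4 : gamma * dot g g <= 2 * bregman h x y.
  apply: le_trans (_ : gamma * (2 * L * bregman h x y) <= _); first by rewrite ler_pM2l.
  nra.
nra.
Qed.

(** * One epoch: shifted optima and accumulated noise *)

Section Average.
Context {R : realType} {d n : nat} (f : 'I_n -> 'rV[R]_d -> R).
Context (mu L gamma : R) (xs : 'rV[R]_d).
Context (n_gt0 : (0 < n)%N).
Context (fdiff : forall i x, differentiable (f i) x).
Context (fsmooth : forall i, smooth L (f i)).
Context (L_gt0 : 0 < L).

(* Compare [xs] with the point reached by the step [- (n L)^-1 G], where [G] is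
   the sum of the gradients at [xs]. *)
Lemma sum_gradient_minimizer : is_minimizer (average f) xs ->
  \sum_(i < n) gradient (f i) xs = 0.
Proof.
move=> xsmin; apply/eqP; rewrite -dot_eq0.
have [G GE] : exists G, G = \sum_(i < n) gradient (f i) xs by eexists.
pose t : R := (n%:R * L)^-1; pose y := xs - t *: G.
have n0 : 0 < n%:R :> R by rewrite ltr0n.
have t0 : 0 < t by rewrite invr_gt0 mulr_gt0.
have nLt : n%:R * L * t = 1 by rewrite divff // gt_eqF // mulr_gt0.
have yx : y - xs = - (t *: G) by rewrite /y addrC addKr.
have H : 0 <= \sum_(i < n) (f i y - f i xs).
  by have := xsmin y; rewrite ler_pM2l ?invr_gt0 // sumrB subr_ge0.
have : \sum_(i < n) bregman (f i) y xs <= \sum_(i < n) L / 2 * (t ^+ 2 * dot G G).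
  apply: ler_sum => i _; apply: le_trans (bregman_le (fdiff i) L y xs L_gt0 (fsmooth i)) _.
  by rewrite yx !dotE; lra.
rewrite sumr_const card_ord -mulr_natl /bregman sumrB -dot_suml -GE yx !dotE => B.
rewrite eq_le dot_ge0 andbT -(pmulr_rle0 _ t0).
(* As n L t = 1, the upper bound is t |G|^2 / 2, while minimality makes the sum of divergences at
   least t |G|^2; hence |G|^2 <= 0. *)
have : n%:R * (L / 2 * (t ^+ 2 * dot G G)) = (n%:R * L * t) * (t * dot G G) / 2.
  by ring.
rewrite nLt; lra.
Qed.

Lemma shifted_opt0 s : shifted_opt f gamma xs s 0 = xs.
Proof. by rewrite /shifted_opt big_pred0 // scaler0 subr0. Qed.

Lemma shifted_optS s (k : 'I_n) :
  shifted_opt f gamma xs s k.+1 =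
  shifted_opt f gamma xs s k - gamma *: gradient (f (s k)) xs.
Proof.
rewrite /shifted_opt (bigD1 k) //= scalerDr opprD addrCA addrC; congr (_ - _ - _).
by congr (_ *: _); apply: eq_bigl => i; rewrite ltnS andbC -ltn_neqAle.
Qed.

Lemma shifted_opt_last s : \sum_(i < n) gradient (f i) xs = 0 ->
  shifted_opt f gamma xs s n = xs.
Proof.
move=> G0; rewrite /shifted_opt (eq_bigl predT) => [|i]; last by rewrite ltn_ord.
by rewrite -(reindex_inj (h := s) (P := predT) (F := fun i => gradient (f i) xs)
  (@perm_inj _ s)) G0 scaler0 subr0.
Qed.

Context (fconv : forall i, strongly_convex mu (f i)).
Context (mu_ge0 : 0 <= mu).
Context (gamma_gt0 : 0 < gamma).
Context (gammaL : gamma * L <= 1).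
Context (gammamu : gamma * mu <= 1).

(** Solution, starting from 0, of the recursion in [epoch_noiseS]: the error entering at step i is
    damped by the k - i - 1 steps after it. *)
Definition epoch_noise (s : 'S_n) (k : nat) : R :=
  2 * gamma * \sum_(i < n | (i < k)%N) (1 - gamma * mu) ^+ (k - i.+1) *
    bregman (f (s i)) (shifted_opt f gamma xs s i) xs.

Lemma epoch_noiseS s (k : 'I_n) :
  epoch_noise s k.+1 = (1 - gamma * mu) * epoch_noise s k +
    2 * gamma * bregman (f (s k)) (shifted_opt f gamma xs s k) xs.
Proof.
rewrite /epoch_noise (bigD1 k) //= subnn expr0 mul1r mulrDr addrC; congr (_ + _).
rewrite mulrCA; congr (_ * _); rewrite mulr_sumr; apply: eq_big => [i|i].
  by rewrite ltnS andbC -ltn_neqAle.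
by rewrite ltnS andbC -ltn_neqAle => ik; rewrite mulrA -exprS subnSK.
Qed.

(** Induction on the number of steps: entry k of [enum 'I_n] is the ordinal k, so iterate and
    shifted optimum both move by a gradient of [f (s k)], and [gradient_step_contract] applies. *)
Lemma epoch_prefix_contract (x : 'rV[R]_d) (s : 'S_n) (k : nat) : (k <= n)%N ->
  enorm (foldl (fun (y : 'rV[R]_d) (i : 'I_n) => y - gamma *: gradient (f (s i)) y)
    x (take k (enum 'I_n)) - shifted_opt f gamma xs s k) ^+ 2
  <= (1 - gamma * mu) ^+ k * enorm (x - xs) ^+ 2 + epoch_noise s k.
Proof.
elim: k => [|k IHk] kn.
  by rewrite take0 shifted_opt0 expr0 mul1r /epoch_noise big_pred0 // mulr0 addr0.
pose i := Ordinal kn.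
rewrite (take_nth i) ?size_enum_ord // foldl_rcons -[k in nth _ _ k]/(val i) nth_ord_enum.
rewrite -[k in shifted_opt _ _ _ _ k.+1]/(val i) shifted_optS.
apply: le_trans
  (gradient_step_contract _ _ mu L gamma _ _ _ _ (fdiff _) (fconv _) (fsmooth _) mu_ge0 gamma_gt0 L_gt0 gammaL) _.
rewrite -[k in epoch_noise _ k.+1]/(val i) epoch_noiseS addrA lerD2r [_ ^+ k.+1]exprS -mulrA -mulrDr.
by rewrite ler_wpM2l ?subr_ge0 // IHk // ltnW.
Qed.

Lemma epoch_contract (x : 'rV[R]_d) (s : 'S_n) : is_minimizer (average f) xs ->
  enorm (epoch f gamma x s - xs) ^+ 2
  <= (1 - gamma * mu) ^+ n * enorm (x - xs) ^+ 2 + epoch_noise s n.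
Proof.
move=> xsmin; have := epoch_prefix_contract x s n (leqnn n).
by rewrite take_oversize ?size_enum_ord // shifted_opt_last // sum_gradient_minimizer.
Qed.

End Average.

(** * Uniform expectation over finite types and tuples *)

Section Expect.
Context {R : realType}.

Lemma expect_affine {W : finType} (a b : R) (F : W -> R) : (0 < #|W|)%N ->
  expect (fun w => a + b * F w) = a + b * expect F.
Proof.
move=> W0; rewrite /expect big_split /= sumr_const -mulr_sumr mulrDl mulrA.
by rewrite -[a *+ _]mulr_natr mulfK // pnatr_eq0 -lt0n.
Qed.

Lemma ler_expect {W : finType} {F G : W -> R} :
  (forall w, F w <= G w) -> expect F <= expect G.
Proof. by move=> FG; rewrite ler_wpM2r ?invr_ge0 // ler_sum. Qed.

Lemma expect_sum {W I : finType} {P : pred I} (F : I -> W -> R) :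
  expect (fun w => \sum_(i | P i) F i w) = \sum_(i | P i) expect (F i).
Proof. by rewrite /expect exchange_big /= mulr_suml. Qed.

Lemma expectZ {W : finType} (a : R) (F : W -> R) :
  expect (fun w => a * F w) = a * expect F.
Proof. by rewrite /expect -mulr_sumr mulrA. Qed.

Lemma expect_tuple0 {W : finType} (F : seq W -> R) :
  expect (fun ss : 0.-tuple W => F ss) = F [::].
Proof.
rewrite /expect card_tuple expn0 divr1 (big_pred1 [tuple]) // => t.
by rewrite [t]tuple0 /= eqxx.
Qed.

(** Tuples of length T + 1 biject with pairs of head and tail; this conditions on the permutation of
    the first epoch. *)
Lemma expect_tupleS {W : finType} {T : nat} (F : seq W -> R) :
  expect (fun ss : T.+1.-tuple W => F ss) =
  expect (fun w => expect (fun ss : T.-tuple W => F (w :: ss))).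
Proof.
rewrite /expect -mulr_suml -mulrA -invfM -natrM !card_tuple mulnC -expnS.
congr (_ / _); rewrite pair_bigA /=.
rewrite (reindex (fun p : W * T.-tuple W => [tuple of p.1 :: p.2])) //=.
exists (fun t : T.+1.-tuple W => (thead t, [tuple of behead t])) => [[w t] _|t _] /=.
  by congr (_, _); apply: val_inj.
by rewrite [RHS]tuple_eta.
Qed.

End Expect.

(** * Mean noise of an epoch and its accumulation over epochs *)

Section Convergence.
Context {R : realType} {d n : nat} (f : 'I_n -> 'rV[R]_d -> R).
Context (mu gamma : R) (xs : 'rV[R]_d).
Context (mu_gt0 : 0 < mu).
Context (gamma_gt0 : 0 < gamma).
Context (gammamu : gamma * mu <= 1).

Let q := 1 - gamma * mu.
Let D := 2 * gamma * shuffling_variance f gamma xs / mu.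

Let q_ge0 : 0 <= q. Proof. by rewrite subr_ge0. Qed.

Lemma shuffling_variance_ge0 : 0 <= shuffling_variance f gamma xs.
Proof. by apply: bigmax_ge_id. Qed.

Lemma expect_bregman_le (i : 'I_n) :
  expect (fun s : 'S_n => bregman (f (s i)) (shifted_opt f gamma xs s i) xs)
    <= gamma * shuffling_variance f gamma xs.
Proof.
have [i0|i0] := posnP i.
  (* Index 0 is outside the maximum, but there the shifted optimum is [xs] and the divergence
     vanishes. *)
  rewrite /expect big1 ?mul0r ?mulr_ge0 ?shuffling_variance_ge0 // ?ltW // => s _.
  by rewrite i0 shifted_opt0 /bregman !subrr dotC dot0l subrr.
rewrite mulrC -ler_pdivrMr // mulrC.
by apply: (@le_bigmax_cond _ _ _ _ _ (fun i : 'I_n => (0 < i)%N) (fun i : 'I_n => gamma^-1 * _)).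
Qed.

Lemma expect_epoch_noise :
  expect (fun s => epoch_noise f mu gamma xs s n) <= D * (1 - q ^+ n).
Proof.
rewrite /epoch_noise expectZ expect_sum.
have : \sum_(i < n | (i < n)%N) expect (fun s : 'S_n => (1 - gamma * mu) ^+ (n - i.+1) *
    bregman (f (s i)) (shifted_opt f gamma xs s i) xs)
   <= (\sum_(i < n) q ^+ (n - i.+1)) * (gamma * shuffling_variance f gamma xs).
  rewrite (eq_bigl predT) => [|i]; last by rewrite ltn_ord.
  rewrite mulr_suml; apply: ler_sum => i _; rewrite expectZ ler_wpM2l ?exprn_ge0 //.
  exact: expect_bregman_le.
have -> : \sum_(i < n) q ^+ (n - i.+1) = \sum_(i < n) q ^+ i.
  by rewrite [RHS](reindex_inj rev_ord_inj).
set S := \sum_(i < n) q ^+ i.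
(* As 1 - q = gamma mu, the geometric sum S turns the factor gamma sigma^2 into (sigma^2 / mu) (1 -
   q^n). *)
have SE : 1 - q ^+ n = gamma * mu * S.
  by rewrite -opprB subrX1 -/S /q; ring.
rewrite SE /D -(ler_pM2l (_ : 0 < 2 * gamma)) ?mulr_gt0 // => /le_trans; apply.
rewrite le_eqVlt; apply/orP; left; apply/eqP; field.
by rewrite gt_eqF.
Qed.

Context (epoch_le : forall x s,
  enorm (epoch f gamma x s - xs) ^+ 2
  <= q ^+ n * enorm (x - xs) ^+ 2 + epoch_noise f mu gamma xs s n).

Lemma card_Sn_gt0 : (0 < #|{: 'S_n}|)%N.
Proof. by apply/card_gt0P; exists 1%g. Qed.

Let D_ge0 : 0 <= D.
Proof. by rewrite divr_ge0 ?mulr_ge0 ?shuffling_variance_ge0 // ltW. Qed.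

(** The first epoch is peeled off, and the induction hypothesis is applied from its random endpoint.
    With Q = q^n, keeping the factor 1 - Q^T closes the induction: D (1 - Q^T) + Q^T D (1 - Q) = D
    (1 - Q^(T+1)). *)
Lemma RR_error_contract T x0 :
  RR_error f gamma x0 xs T <=
  (q ^+ n) ^+ T * enorm (x0 - xs) ^+ 2 + D * (1 - (q ^+ n) ^+ T).
Proof.
have Q0 : 0 <= q ^+ n by rewrite exprn_ge0.
elim: T x0 => [|T IHT] x0.
  rewrite /RR_error (expect_tuple0 (fun ss => enorm (run f gamma x0 ss - xs) ^+ 2)).
  by rewrite expr0 subrr mulr0 addr0 mul1r.
rewrite /RR_error (expect_tupleS (fun ss => enorm (run f gamma x0 ss - xs) ^+ 2)).
have el := epoch_le; set Q := q ^+ n in Q0 el IHT *.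
pose c := D * (1 - Q ^+ T) + Q ^+ T * (Q * enorm (x0 - xs) ^+ 2).
apply: (@le_trans _ _ (expect (fun s => c + Q ^+ T * epoch_noise f mu gamma xs s n))).
  apply: ler_expect => s; apply: le_trans (IHT (epoch f gamma x0 s)) _.
  have := ler_wpM2l (exprn_ge0 T Q0) (el x0 s).
  by rewrite mulrDr /c; lra.
rewrite expect_affine ?card_Sn_gt0 // /c (exprS Q).
have : Q ^+ T * expect (fun s => epoch_noise f mu gamma xs s n) <= Q ^+ T * (D * (1 - Q)).
  by rewrite ler_wpM2l ?exprn_ge0 // expect_epoch_noise.
lra.
Qed.

(** With one permutation the same noise recurs in every epoch, so the bound unrolls for each fixed
    [s] and the expectation is taken only afterwards. *)
Lemma run_nseq_le T x0 s :
  enorm (run f gamma x0 (nseq T s) - xs) ^+ 2 <=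
  (q ^+ n) ^+ T * enorm (x0 - xs) ^+ 2 +
  (\sum_(t < T) (q ^+ n) ^+ t) * epoch_noise f mu gamma xs s n.
Proof.
have Q0 : 0 <= q ^+ n by rewrite exprn_ge0.
elim: T x0 => [|T IHT] x0; first by rewrite big_ord0 mul0r addr0 expr0 mul1r.
apply: le_trans (IHT (epoch f gamma x0 s)) _.
have := ler_wpM2l (exprn_ge0 T Q0) (epoch_le x0 s).
by rewrite big_ord_recr /= (exprS (q ^+ n)); lra.
Qed.

Lemma SO_error_contract T x0 :
  SO_error f gamma x0 xs T <=
  (q ^+ n) ^+ T * enorm (x0 - xs) ^+ 2 + D * (1 - (q ^+ n) ^+ T).
Proof.
have Q0 : 0 <= q ^+ n by rewrite exprn_ge0.
apply: le_trans (ler_expect (run_nseq_le T x0)) _.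
rewrite expect_affine ?card_Sn_gt0 // lerD2l.
have -> : 1 - (q ^+ n) ^+ T = (1 - q ^+ n) * \sum_(t < T) (q ^+ n) ^+ t.
  by rewrite -opprB subrX1 -mulNr opprB.
rewrite (mulrA D) mulrC ler_wpM2r ?expect_epoch_noise //.
by apply: sumr_ge0 => t _; rewrite exprn_ge0.
Qed.

Lemma drop_noise_factor T x0 :
  (q ^+ n) ^+ T * enorm (x0 - xs) ^+ 2 + D * (1 - (q ^+ n) ^+ T) <=
  q ^+ (n * T) * enorm (x0 - xs) ^+ 2 + D.
Proof.
rewrite exprM lerD2l ler_piMr // lerBlDr lerDl.
by rewrite !exprn_ge0.
Qed.

End Convergence.

(** * Assembly, with dimension 0 apart *)

Lemma enorm_dim0 (R : realType) (u : 'rV[R]_0) : enorm u = 0.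
Proof. by rewrite /enorm /dot big_ord0 sqrtr0. Qed.

Theorem theorem1 (R : realType) (d n : nat) (hn : (0 < n)%N)
    (f : 'I_n -> 'rV[R]_d -> R) (mu L gamma : R) (x0 xs : 'rV[R]_d) (T : nat)
    (hmu : 0 < mu)
    (fdiff : forall (i : 'I_n) (x : 'rV[R]_d), differentiable (f i) x)
    (fconv : forall i : 'I_n, strongly_convex mu (f i))
    (fsmooth : forall i : 'I_n, smooth L (f i))
    (avgsmooth : smooth L (average f))
    (xsmin : is_minimizer (average f) xs)
    (gamma_gt0 : 0 < gamma) (gamma_le : gamma <= 1 / L) :
  RR_error f gamma x0 xs T <=
    (1 - gamma * mu) ^+ (n * T) * enorm (x0 - xs) ^+ 2
    + 2 * gamma * shuffling_variance f gamma xs / mu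
  /\
  SO_error f gamma x0 xs T <=
    (1 - gamma * mu) ^+ (n * T) * enorm (x0 - xs) ^+ 2
    + 2 * gamma * shuffling_variance f gamma xs / mu.
Proof.
(* The stepsize bound forces this, including against L = 0, where [1 / L] is 0. *)
have L_gt0 : 0 < L.
  by move: (lt_le_trans gamma_gt0 gamma_le); rewrite div1r invr_gt0.
have gammaL : gamma * L <= 1 by rewrite -ler_pdivlMr.
(* In dimension 0 nothing forces mu <= L, so gamma mu <= 1 may fail; there all norms vanish and the
   bound is just the nonnegative noise term. *)
case: d f x0 xs fdiff fconv fsmooth avgsmooth xsmin => [|d'] {}f {}x0 {}xs
  {}fdiff {}fconv {}fsmooth {}avgsmooth {}xsmin.
  have D0 : 0 <= 2 * gamma * shuffling_variance f gamma xs / mu.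
    by rewrite divr_ge0 ?mulr_ge0 ?shuffling_variance_ge0 // ltW.
  rewrite enorm_dim0 expr0n mulr0 add0r /RR_error /SO_error /expect.
  by split; rewrite big1 ?mul0r // => w _; rewrite enorm_dim0 expr0n.
have mu_le : mu <= L.
  by apply: (strongly_convex_le_smooth _ _ _ _ (f (Ordinal hn))).
have gammamu : gamma * mu <= 1 by apply: le_trans gammaL; rewrite ler_pM2l.
have E x s := epoch_contract f mu L gamma xs hn fdiff fsmooth L_gt0 fconv (ltW hmu)
  gamma_gt0 gammaL gammamu x s xsmin.
split; apply: le_trans (drop_noise_factor _ _ _ _ hmu gamma_gt0 gammamu T x0).
  exact: RR_error_contract.
exact: SO_error_contract.
Qed.
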